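(* If a finitely generated semigroup $S$ satisfies the right [respectively, left] F\o lner condition then, for any finite choice of generators $X$ for $S$, the associated right [respectively, left] random walk Markov operator on $\ell_2(S^1)$ is either not defined or has spectral radius at least $1$.
   Context: $S^1$ denotes $S$ with an identity element adjoined if $S$ has no identity, and $S^1=S$ otherwise. A finite choice of generators for a semigroup $S$ is a finite set $X$ of symbols together with a surjective morphism $X^+\to S$, $w\mapsto\overline{w}$, from the free semigroup on $X$. A semigroup $S$ satisfies the right F\o lner condition if for every finite subset $H$ of $S$ and every $\epsilon>0$ there is a finite non-empty subset $F$ of $S$ with $|Fs\setminus F|\leq\epsilon|F|$ for all $s\in H$. The left F\o lner condition is the left-right dual: $|sF\setminus F|\leq\epsilon|F|$ for all $s\in H$. The right random walk Markov operator associated with $X$ is given by the $S^1\times S^1$ matrix $M_{s,t}=|\{x\in X: s\overline{x}=t\}|/|X|$, acting by $(vM)(t)=\sum_{s\in S^1}v(s)M_{s,t}$. The left random walk Markov operator is given in the same way by the matrix with $(s,t)$ entry $|\{x\in X:\overline{x}s=t\}|/|X|$. The operator is ''defined on $\ell_2(S^1)$'' if for every $v\in\ell_2(S^1)$ all these sums converge and the result lies in $\ell_2(S^1)$; in this case it is automatically bounded. The spectral radius of $M$ is the supremum of $|\lambda|$ over all complex $\lambda$ such that $M-\lambda I$ is singular (not invertible); equivalently it equals $\limsup_{n\to\infty}\|M^n\|_2^{1/n}$, where $\|\cdot\|_2$ is the operator norm on $\ell_2(S^1)$. *)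

(* Defs.v *)
From HB Require Import structures.
From mathcomp Require Import all_boot all_order all_algebra finmap.
From mathcomp Require Import all_classical all_reals all_analysis.
From mathcomp Require Import complex.
From mathcomp.analysis.showcase Require summability.

Set Implicit Arguments.
Unset Strict Implicit.
Unset Printing Implicit Defensive.

Import Order.TTheory GRing.Theory Num.Theory.
Import numFieldNormedType.Exports.

Local Open Scope classical_set_scope.
Local Open Scope ring_scope.

Local Notation normc := ComplexField.Normc.normc.

Definition is_identity (S : semigroupType) (e : S) : Prop :=
  forall s : S, (e * s)%g = s /\ (s * e)%g = s.

Definition has_identity (S : semigroupType) : Prop :=
  exists e : S, is_identity e.

(* [S^1]: [Some s] is the element [s] of [S], and [None] is the adjoined
   identity, which is excluded when [S] already has an identity. *)
Definition adjoin1 (S : semigroupType) : Type :=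
  {a : option S | `[< has_identity S >] ==> isSome a}.

HB.instance Definition _ (S : semigroupType) := Choice.on (adjoin1 S).

Section Adjoin1.
Variable S : semigroupType.

Definition omul (a b : option S) : option S :=
  match a, b with
  | Some s, Some t => Some (s * t)%g
  | None, _ => b
  | _, None => a
  end.

Fact omulA : associative omul.
Proof. by move=> [a|] [b|] [c|] //=; rewrite mulgA. Qed.

Fact omul_subproof (a b : adjoin1 S) :
  `[< has_identity S >] ==> isSome (omul (val a) (val b)).
Proof. by case: a b => [[s|] a1] [[t|] b1]. Qed.

Definition adjoin1_mul (a b : adjoin1 S) : adjoin1 S :=
  exist _ (omul (val a) (val b)) (omul_subproof a b).

Fact adjoin1_mulA : associative adjoin1_mul.
Proof. by move=> a b c; apply: val_inj; rewrite /= omulA. Qed.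

HB.instance Definition _ := isSemigroup.Build (adjoin1 S) adjoin1_mulA.

Definition to_adjoin1 (s : S) : adjoin1 S :=
  exist _ (Some s) (implybT `[< has_identity S >]).

Lemma to_adjoin1M (s t : S) :
  to_adjoin1 (s * t)%g = (to_adjoin1 s * to_adjoin1 t)%g.
Proof. exact: val_inj. Qed.

Lemma to_adjoin1_inj : injective to_adjoin1.
Proof. by move=> s t /(congr1 val) [->]. Qed.

Lemma to_adjoin1_surj : has_identity S -> forall a, exists s, to_adjoin1 s = a.
Proof.
move=> S1 [[s|] a1]; first by exists s; apply: val_inj.
by exfalso; move/asboolP: S1 a1 => ->.
Qed.

Lemma adjoin1_has_identity : has_identity (adjoin1 S).
Proof.
have [[e e1]|nS1] := pselect (has_identity S).
  exists (to_adjoin1 e) => a.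
  have [s <-] := to_adjoin1_surj (ex_intro _ e e1) a.
  by rewrite -!to_adjoin1M; have [-> ->] := e1 s.
have None1 : `[< has_identity S >] ==> isSome (None : option S).
  by rewrite implybF; apply/asboolPn.
by exists (exist _ None None1) => a; split; apply: val_inj; case: a => -[].
Qed.

End Adjoin1.

Definition free_semigroup (X : choiceType) : Type := {w : seq X | w != [::]}.

HB.instance Definition _ (X : choiceType) := Choice.on (free_semigroup X).

Section FreeSemigroup.
Variable X : choiceType.

Fact cat_subproof (u v : free_semigroup X) : val u ++ val v != [::].
Proof. by case: u => -[]. Qed.

Definition free_mul (u v : free_semigroup X) : free_semigroup X :=
  exist _ (val u ++ val v) (cat_subproof u v).

Fact free_mulA : associative free_mul.
Proof. by move=> u v w; apply: val_inj; rewrite /= catA. Qed.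

HB.instance Definition _ := isSemigroup.Build (free_semigroup X) free_mulA.

Definition letter (x : X) : free_semigroup X := exist _ [:: x] isT.

End FreeSemigroup.

Definition choice_of_generators (S : semigroupType) (X : finType)
    (ev : {multiplicative free_semigroup X -> S}) : Prop :=
  forall s : S, exists w, ev w = s.

Definition finitely_generated (S : semigroupType) : Prop :=
  exists (X : finType) (ev : {multiplicative free_semigroup X -> S}),
    choice_of_generators ev.

Section Folner.
Local Open Scope fset_scope.

Definition right_folner (R : realType) (S : semigroupType) : Prop :=
  forall (H : {fset S}) (eps : R), 0 < eps ->
  exists2 F : {fset S}, F != fset0 &
    forall s, s \in H ->
      #|` [fset (f * s)%g | f in F] `\` F|%:R <= eps * #|` F|%:R.

Definition left_folner (R : realType) (S : semigroupType) : Prop :=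
  forall (H : {fset S}) (eps : R), 0 < eps ->
  exists2 F : {fset S}, F != fset0 &
    forall s, s \in H ->
      #|` [fset (s * f)%g | f in F] `\` F|%:R <= eps * #|` F|%:R.

End Folner.

Section L2.
Variables (R : realType) (T : choiceType).

Definition sqsum (v : T -> R[i]) : \bar R :=
  \esum_(t in [set: T]) ((normc (v t)) ^+ 2)%:E.

Definition l2 : set (T -> R[i]) := [set v | (sqsum v < +oo)%E].

Definition l2norm (v : T -> R[i]) : R := Num.sqrt (fine (sqsum v)).

(* [T] carries no order: convergence of a sum over [T] is that of the net of
   its finite partial sums. *)
Definition summable_family (f : T -> R[i]) : Prop :=
  cvg (summability.partial_sum (f : T -> R[i]^o) @ summability.totally).

Definition family_sum (f : T -> R[i]) : R[i] :=
  summability.sum (f : T -> R[i]^o).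

Definition mxact (M : T -> T -> R[i]) (v : T -> R[i]) : T -> R[i] :=
  fun t => family_sum (fun s => v s * M s t).

Definition defined_on_l2 (M : T -> T -> R[i]) : Prop :=
  forall v, l2 v ->
    (forall t, summable_family (fun s => v s * M s t)) /\ l2 (mxact M v).

Definition l2_bounded_linear (A : (T -> R[i]) -> T -> R[i]) : Prop :=
  [/\ forall v, l2 v -> l2 (A v),
      forall (a : R[i]) u v, l2 u -> l2 v ->
        A (fun t => a * u t + v t) = (fun t => a * A u t + A v t) &
      exists K : R, forall v, l2 v -> l2norm (A v) <= K * l2norm v].

(* Invertibility in the algebra of bounded operators on [l2]. *)
Definition l2_invertible (A : (T -> R[i]) -> T -> R[i]) : Prop :=
  exists2 B, l2_bounded_linear B &
    forall v, l2 v -> B (A v) = v /\ A (B v) = v.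

Definition spectrum (M : T -> T -> R[i]) : set R[i] :=
  [set lambda |
    ~ l2_invertible (fun v => (fun t => mxact M v t - lambda * v t))].

(* The supremum is taken in the extended reals, so that it is meaningful
   without first knowing that the spectrum is bounded. *)
Definition spectral_radius (M : T -> T -> R[i]) : \bar R :=
  ereal_sup [set (normc lambda)%:E | lambda in spectrum M].

End L2.

Section Markov.
Variables (R : realType) (S : semigroupType) (X : finType).
Variable ev : {multiplicative free_semigroup X -> S}.

Definition right_markov (s t : adjoin1 S) : R[i] :=
  #|[set x : X | (s * to_adjoin1 (ev (letter x)))%g == t]%SET|%:R / #|X|%:R.

Definition left_markov (s t : adjoin1 S) : R[i] :=
  #|[set x : X | (to_adjoin1 (ev (letter x)) * s)%g == t]%SET|%:R / #|X|%:R.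

End Markov.

(* Main.v *)
Require Import Defs.
From HB Require Import structures.
From mathcomp Require Import all_boot all_order all_algebra finmap.
From mathcomp Require Import all_classical all_reals all_analysis.
From mathcomp Require Import complex ring lra.
From mathcomp.analysis.showcase Require summability.

(** Both random walks are instances of one situation: a
    finite set [X] acts by maps on a set [T], and [P] moves the mass at [s] to
    the points [act x s] with equal weights.  [P] has nonnegative entries, and
    this makes real parameters suffice: if [P] is defined on [l2], then some
    real [lambda >= 1] lies in its spectrum.

    Suppose that [P - lambda] is invertible for every real [lambda >= 1].  For
    a finitely supported [v >= 0] consider the partial Neumann sums
    [s_n = sum_(k < n) lambda^-(k+1) P^k v], and call [lambda] good when
    [|s_n|^2 <= C |v|^2] with [C] independent of [n] and [v].  By positivity
    the good parameters form an up-closed set; it contains all large ones since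
    [P] is bounded ([push_bounded]).  Let [l0] be their infimum.  If [1] were
    not good, then [l0 >= 1].  Invertibility at [l0] bounds [P - l0] from below,
    which gives one constant [C] for all good parameters near [l0]
    ([neumann_bounded_near]); and a good parameter with constant [C] can be
    lowered by an amount depending on [C] only ([neumann_bounded_down]).  This
    contradicts the choice of [l0], so [lambda = 1] is good
    ([neumann_bounded_from]).

    The Folner condition excludes this ([folner_not_neumann_bounded]).  Start
    from [v], the indicator of a Folner set [F], with [lambda = 1], so that
    [s_(n+1) = v + P s_n]: every step adds mass [|F|] to [F], and loses only
    the mass that [s_n] puts on the points of [F] leaving [F].  There are few
    such points: the condition bounds their images, and boundedness of [P]
    bounds the fibres of the action ([card_exits]).  As [|s_n|^2 <= C |F|], the
    loss is at most [|F| / 2], so the mass of [s_n] on [F] is at least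
    [n |F| / 2]; but [|s_n|^2 <= C |F|] also keeps it below a fixed multiple of
    [|F|].

    Only finitely supported nonnegative functions are ever iterated.  The space
    [l2] enters through two facts: an everywhere defined nonnegative matrix is
    bounded on these functions, and an inverse of [P - lambda] gives a lower
    bound for it there. *)

Set Implicit Arguments.
Unset Strict Implicit.
Unset Printing Implicit Defensive.

Import Order.TTheory GRing.Theory Num.Theory.
Import numFieldNormedType.Exports.

Local Open Scope classical_set_scope.
Local Open Scope ring_scope.
Local Open Scope complex_scope.

Local Notation normc := ComplexField.Normc.normc.

(** * Neumann sums of a positive operator on a cone *)

(** [Q] plays the role of a squared norm on the cone [D], which orders the space
    by [u <= u + v] for [v] in [D].  Working with squares, the parallelogram
    bound [gaugeD] replaces the triangle inequality.  The laws of [P] are stated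
    on the cone because the intended [P] is given by sums that take a default
    value on functions of infinite support. *)
Record positive_operator (R : realType) (V : lmodType R) (D : set V)
    (Q : V -> R) (P : V -> V) : Prop := PositiveOperator {
  cone0 : D 0;
  coneD : forall u v, D u -> D v -> D (u + v);
  coneZ : forall c u, 0 <= c -> D u -> D (c *: u);
  gauge_ge0 : forall u, 0 <= Q u;
  gaugeZ : forall c u, Q (c *: u) = c ^+ 2 * Q u;
  gaugeD : forall u v, D u -> D v -> Q (u + v) <= 2 * (Q u + Q v);
  gauge_le : forall u v, D u -> D v -> Q u <= Q (u + v);
  cone_op : forall u, D u -> D (P u);
  opD : forall u v, D u -> D v -> P (u + v) = P u + P v;
  opZ : forall c u, 0 <= c -> D u -> P (c *: u) = c *: P u
}.

Section Neumann.
Variables (R : realType) (V : lmodType R) (D : set V) (Q : V -> R) (P : V -> V).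
Hypothesis posP : positive_operator D Q P.

Let D0 := cone0 posP.
Let DD := coneD posP.
Let DZ := coneZ posP.
Let DP := cone_op posP.
Let Q0 := gauge_ge0 posP.

(** The partial sum [sum_(k < n) l^-(k+1) P^k v]; its limit, when it exists, is
    the resolvent [(l - P)^-1 v]. *)
Definition neumann (l : R) (v : V) (n : nat) : V :=
  iter n (fun u => l^-1 *: (v + P u)) 0.

(** The term [l^-n P^n v]. *)
Definition neumann_rest (l : R) (v : V) (n : nat) : V :=
  iter n (fun u => l^-1 *: P u) v.

Definition neumann_bounded (l C : R) : Prop :=
  forall v n, D v -> Q (neumann l v n) <= C * Q v.

(** Here [P - l] is bounded below on the cone.  The image [P u - l u] has no
    sign, so it appears as a difference [b - a] of two vectors of the cone. *)
Definition bounded_below (l K : R) : Prop :=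
  forall u a b, D u -> D a -> D b -> P u + a = l *: u + b ->
    Q u <= K * (Q a + Q b).

Let neumannS l v n :
  neumann l v n.+1 = l^-1 *: (v + P (neumann l v n)).
Proof. by []. Qed.

Let neumann_restS l v n :
  neumann_rest l v n.+1 = l^-1 *: P (neumann_rest l v n).
Proof. by []. Qed.

Lemma op0 : P 0 = 0.
Proof. by have := opZ posP (lexx 0) D0; rewrite !scale0r. Qed.

Lemma cone_neumann l v n : 0 < l -> D v -> D (neumann l v n).
Proof.
move=> l0 Dv; elim: n => //= n IH; apply: DZ; first by rewrite invr_ge0 ltW.
by apply: DD => //; apply: DP.
Qed.

Lemma cone_neumann_rest l v n : 0 < l -> D v -> D (neumann_rest l v n).
Proof.
move=> l0 Dv; elim: n => //= n IH; apply: DZ; first by rewrite invr_ge0 ltW.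
exact: DP.
Qed.

Lemma neumannS_rest l v n : 0 < l -> D v ->
  neumann l v n.+1 = neumann l v n + l^-1 *: neumann_rest l v n.
Proof.
move=> l0 Dv; have l'0 : 0 <= l^-1 by rewrite invr_ge0 ltW.
elim: n => [|n IH]; first by rewrite /= op0 addr0 add0r.
rewrite neumannS {1}IH (opD posP).
- by rewrite addrA scalerDr (opZ posP)//; exact: cone_neumann_rest.
- exact: cone_neumann.
- by apply: DZ => //; exact: cone_neumann_rest.
Qed.

(** [(l - P) s_n = v - l^-n P^n v], the telescoping identity. *)
Lemma neumann_restE l v n : 0 < l -> D v ->
  P (neumann l v n) + v = l *: neumann l v n + neumann_rest l v n.
Proof.
move=> l0 Dv; have ln : l != 0 by rewrite gt_eqF.
have := congr1 (fun x => l *: x) (neumannS_rest n l0 Dv).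
rewrite neumannS scalerA divff// scale1r.
by rewrite scalerDr scalerA divff// scale1r addrC.
Qed.

Lemma neumann_le_index l v n m : 0 < l -> D v -> (n <= m)%N ->
  exists2 w, D w & neumann l v m = neumann l v n + w.
Proof.
move=> l0 Dv; elim: m => [|m IH].
  by rewrite leqn0 => /eqP ->; exists 0; rewrite ?addr0.
rewrite leq_eqVlt => /predU1P[->|]; first by exists 0; rewrite ?addr0.
rewrite ltnS => /IH[w Dw e]; exists (w + l^-1 *: neumann_rest l v m).
  apply: DD => //; apply: DZ; first by rewrite invr_ge0 ltW.
  exact: cone_neumann_rest.
by rewrite neumannS_rest// e addrA.
Qed.

(** Positivity: every term [l^-(k+1) P^k v] decreases when [l] grows. *)
Lemma neumann_le_param l m v n : 0 < l -> l <= m -> D v ->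
  exists2 w, D w & neumann l v n = neumann m v n + w.
Proof.
move=> l0 lm Dv; have m0 : 0 < m by exact: lt_le_trans lm.
have Dm k : D (neumann m v k) by exact: cone_neumann.
elim: n => [|n [w Dw IH]]; first by exists 0; rewrite ?addr0.
exists ((l^-1 - m^-1) *: (v + P (neumann m v n)) + l^-1 *: P w).
  apply: DD; apply: DZ; last exact: DP.
  - by rewrite subr_ge0 lef_pV2 ?posrE.
  - by apply: DD => //; exact: DP.
  - by rewrite invr_ge0 ltW.
rewrite !neumannS IH (opD posP)//.
by rewrite [RHS]addrA -scalerDl subrKC -scalerDr addrA.
Qed.

Lemma neumann_bounded_le (l m C : R) : 0 < l -> l <= m ->
  neumann_bounded l C -> neumann_bounded m C.
Proof.
move=> l0 lm lC v n Dv; have [w Dw e] := neumann_le_param n l0 lm Dv.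
apply: le_trans (lC v n Dv); rewrite e; apply: (gauge_le posP) => //.
by apply: cone_neumann => //; exact: lt_le_trans lm.
Qed.

Lemma neumann_restZ l m v n : 0 < l -> 0 < m -> D v ->
  neumann_rest l v n = (m / l) ^+ n *: neumann_rest m v n.
Proof.
move=> l0 m0 Dv; elim: n => [|n IH]; first by rewrite expr0 scale1r.
rewrite !neumann_restS IH (opZ posP).
- rewrite !scalerA exprSr; congr (_ *: _); field.
  by rewrite !gt_eqF.
- by rewrite exprn_ge0// divr_ge0// ltW.
- exact: cone_neumann_rest.
Qed.

(** The general term for [l] is [(m / l)^n] times the one for [m], which is
    bounded because it is, up to the factor [m], a difference of consecutive
    bounded partial sums. *)
Lemma neumann_rest_small (l m C eta : R) : 0 < m -> m < l -> 0 < eta ->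
  neumann_bounded m C ->
  exists n0, forall v n, D v -> (n0 <= n)%N ->
    Q (neumann_rest l v n) <= eta * Q v.
Proof.
move=> m0 ml eta0 mC; have l0 : 0 < l by exact: lt_trans ml.
have restm v n : D v -> Q (neumann_rest m v n) <= m ^+ 2 * C * Q v.
  move=> Dv; have := mC v n.+1 Dv; rewrite neumannS_rest// => h.
  have -> : neumann_rest m v n = m *: (m^-1 *: neumann_rest m v n).
    by rewrite scalerA divff ?gt_eqF// scale1r.
  rewrite (gaugeZ posP) -mulrA ler_wpM2l ?sqr_ge0//; apply: le_trans h.
  rewrite addrC; apply: (gauge_le posP); last exact: cone_neumann.
  by apply: DZ; [rewrite invr_ge0 ltW|exact: cone_neumann_rest].
pose q := (m / l) ^+ 2.
have q0 : 0 <= q by exact: sqr_ge0.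
have q1 : `|q| < 1.
  have ml0 : 0 <= m / l by rewrite divr_ge0// ltW.
  by rewrite ger0_norm// expr_lt1// ltr_pdivrMr// mul1r.
pose B := `|m ^+ 2 * C| + 1.
have B0 : 0 < B by rewrite ltr_wpDl.
have /cvgrPdist_le/(_ (eta / B)) := cvg_expr q1.
case; first by rewrite divr_gt0.
move=> n0 _ H; exists n0 => v n Dv n0n.
rewrite (neumann_restZ n l0 m0 Dv) (gaugeZ posP) -exprM mulnC exprM -/q.
have := H n n0n; rewrite /= sub0r normrN ger0_norm ?(exprn_ge0 n q0)// => qn.
apply: (@le_trans _ _ (eta / B * (B * Q v))); last first.
  by rewrite mulrA divfK ?gt_eqF.
apply: ler_pM; [exact: exprn_ge0|exact: Q0|exact: qn|].
apply: le_trans (restm v n Dv) _; rewrite ler_wpM2r//.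
by rewrite (le_trans (ler_norm _))// lerDl.
Qed.

(** The hypothesis says [t <= l^-1 (w + P t)], and iterating it bounds [t] by
    the Neumann sums of [w] up to the term [l^-n P^n t]. *)
Lemma subsolution_le (l : R) w t r n : 0 < l -> D w -> D t -> D r ->
  P t + w = l *: t + r ->
  exists2 d, D d & neumann l w n + neumann_rest l t n = t + d.
Proof.
move=> l0 Dw Dt Dr e; have ln : l != 0 by rewrite gt_eqF.
have l'0 : 0 <= l^-1 by rewrite invr_ge0 ltW.
elim: n => [|n [d Dd IH]]; first by exists 0; rewrite //= add0r addr0.
exists (l^-1 *: (r + P d)).
  by apply: DZ => //; apply: DD => //; apply: DP.
rewrite neumannS neumann_restS -scalerDr -addrA.
have Ds : D (neumann l w n) by exact: cone_neumann.
have Dr' : D (neumann_rest l t n) by exact: cone_neumann_rest.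
rewrite -(opD posP)// IH (opD posP)// addrCA addrA e.
by rewrite !scalerDr scalerA mulVf// scale1r addrA.
Qed.

(** A Neumann sum [t] for [l - d] satisfies [l t <= (v + d t) + P t], so the
    bound at [l] gives [Q t <= C' (Q v + d^2 Q t)], and a small [d] allows the
    last term to be absorbed.  A bound at some [m < l], whose constant does not
    enter the result, makes the remainder vanish. *)
Lemma neumann_bounded_down (l m d C C' : R) : 0 <= C -> 0 < m -> m < l ->
  neumann_bounded m C' -> neumann_bounded l C ->
  0 <= d -> d < l -> 16 * C * d ^+ 2 <= 1 ->
  neumann_bounded (l - d) (8 * C).
Proof.
move=> C0 m0 ml mC' lC d0 dl dC v n Dv.
have l0 : 0 < l by exact: lt_trans ml.
have ld0 : 0 < l - d by rewrite subr_gt0.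
have e8 : 0 < 8^-1 :> R by rewrite invr_gt0.
have [n0 small] := neumann_rest_small m0 ml e8 mC'.
set t := neumann _ v n; have Dt : D t by exact: cone_neumann.
have Ddt : D (d *: t) by exact: DZ.
have Dw : D (v + d *: t) by exact: DD.
have e : P t + (v + d *: t) = l *: t + neumann_rest (l - d) v n.
  by rewrite addrA neumann_restE// addrAC -scalerDl subrK.
have [f Df tE] := subsolution_le n0 l0 Dw Dt (cone_neumann_rest n ld0 Dv) e.
have le1 : Q t <= 2 * (C * (2 * (Q v + d ^+ 2 * Q t)) + 8^-1 * Q t).
  apply: le_trans (gauge_le posP Dt Df) _; rewrite -tE.
  apply: le_trans (gaugeD posP _ _) _; first exact: cone_neumann.
    exact: cone_neumann_rest.
  rewrite ler_pM2l// lerD ?small//.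
  apply: le_trans (lC _ n0 Dw) _; rewrite ler_wpM2l//.
  by rewrite -(gaugeZ posP); exact: (gaugeD posP).
have : 16 * C * d ^+ 2 * Q t <= 1 * Q t by rewrite ler_wpM2r.
move: (Q t) (Q v) (d ^+ 2) le1 => x y z; lra.
Qed.

(** The sum [s = s_n] at [l] almost solves [(l0 - P) s = v - (l - l0) s], so the
    lower bound at [l0] controls [Q s] by [Q v] plus a small multiple of [Q s].
    The resulting constant [6 K] does not depend on the constant [C] known
    at [m]. *)
Lemma neumann_bounded_near (l0 l m K C : R) :
  0 <= K -> bounded_below l0 K ->
  0 < m -> m < l -> neumann_bounded m C ->
  l0 <= l -> 4 * K * (l - l0) ^+ 2 <= 1 ->
  neumann_bounded l (6 * K).
Proof.
move=> K0 low m0 ml mC l0l small v n Dv.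
have lp : 0 < l by exact: lt_trans ml.
have [n0 rest] := neumann_rest_small m0 ml ltr01 mC.
(* The remainder is small from the index [n0] on; the Neumann sums increase with
   the index, so a bound at [N >= n] gives one at [n]. *)
pose N := maxn n n0.
have [w Dw sE] := neumann_le_index lp Dv (leq_maxl n n0).
apply: (@le_trans _ _ (Q (neumann l v N))).
  by rewrite sE; apply: (gauge_le posP) => //; exact: cone_neumann.
set s := neumann l v N; have Ds : D s by exact: cone_neumann.
have Dr : D (neumann_rest l v N) by exact: cone_neumann_rest.
have dl : 0 <= l - l0 by rewrite subr_ge0.
have Dds : D ((l - l0) *: s) by exact: DZ.
have e : P s + v = l0 *: s + ((l - l0) *: s + neumann_rest l v N).
  by rewrite neumann_restE// addrA -scalerDl addrCA subrr addr0.
have := low _ _ _ Ds Dv (DD Dds Dr) e.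
have := gaugeD posP Dds Dr; rewrite (gaugeZ posP).
have := rest v N Dv (leq_maxr _ _); rewrite mul1r.
have : 4 * K * (l - l0) ^+ 2 * Q s <= 1 * Q s by rewrite ler_wpM2r.
move: (Q s) (Q v) (Q (neumann_rest _ _ _)) (Q (_ + _)) ((l - l0) ^+ 2).
move=> qs qv qr qb z h1 h2 h3 h4.
have := ler_wpM2l K0 h3; have := ler_wpM2l K0 h2; lra.
Qed.

(** For this [l] both [l^2 >= 4] and [l^2 >= 4 K], so the recursion gives
    [Q s_(n+1) <= (Q v + Q s_n) / 2]. *)
Lemma neumann_bounded_large (K : R) : 0 <= K ->
  (forall v, D v -> Q (P v) <= K * Q v) -> neumann_bounded (2 * (1 + K)) 1.
Proof.
move=> K0 PK v n Dv; rewrite mul1r; set l := 2 * (1 + K).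
have l0 : 0 < l by rewrite mulr_gt0// ltr_pwDl.
elim: n => [|n IH].
  by rewrite /= -(scale0r (0 : V)) (gaugeZ posP) expr0n mul0r.
rewrite neumannS (gaugeZ posP) exprVn ler_pdivrMl ?exprn_gt0//.
have Ds : D (neumann l v n) by exact: cone_neumann.
apply: le_trans (gaugeD posP Dv (DP Ds)) _.
have := PK _ Ds; have := ler_wpM2l K0 IH; rewrite /l exprMn.
have : 0 <= K * Q v by rewrite mulr_ge0.
have : 0 <= K * K * Q v by rewrite !mulr_ge0.
have := Q0 v; move: (Q _) (Q _) (Q _) => x y z; lra.
Qed.

(** The good parameters cannot have an infimum [l0 >= a]: just above [l0] they
    share a constant, so one of them can be lowered past [l0]. *)
Theorem neumann_bounded_from (a K : R) : 0 < a -> 0 <= K ->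
  (forall v, D v -> Q (P v) <= K * Q v) ->
  (forall l, a <= l -> exists K', bounded_below l K') ->
  exists2 C, 0 <= C & neumann_bounded a C.
Proof.
move=> a0 K0 PK low; apply: contrapT => nb.
pose A := [set l | 0 < l /\ exists2 C, 0 <= C & neumann_bounded l C].
have Al : lbound A a.
  move=> l [l0 [C C0 lC]]; rewrite leNgt; apply/negP => la; apply: nb.
  by exists C => //; exact: neumann_bounded_le (ltW la) lC.
have A0 : A !=set0.
  exists (2 * (1 + K)); split; first by rewrite mulr_gt0// ltr_pwDl.
  by exists 1 => //; exact: neumann_bounded_large.
have hA : has_inf A by split => //; exists a.
pose l0 := inf A.
have al0 : a <= l0 by exact: lb_le_inf.
have [K' low'] := low _ al0.
pose k := 1 + `|K'|.
have k1 : 1 <= k by rewrite lerDl.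
have k0 : 0 < k by exact: lt_le_trans k1.
have lowk : bounded_below l0 k.
  move=> u x y Du Dx Dy e; apply: le_trans (low' _ _ _ Du Dx Dy e) _.
  by rewrite ler_wpM2r ?addr_ge0// (le_trans (ler_norm _))// lerDr.
(* [e] meets the smallness conditions of both perturbation lemmas for the
   constant [6 * k]; the good parameter [l0 + e / 2] is lowered by [e], and
   [e <= a / 2] keeps the result positive. *)
pose e := Num.min (100 * k)^-1 (a / 2).
have e0 : 0 < e by rewrite lt_min invr_gt0 mulr_gt0// divr_gt0.
have ea : e <= a / 2 by rewrite ge_min lexx orbT.
have ek : 100 * k * e <= 1.
  by rewrite -ler_pdivlMl ?mulr_gt0// mulr1 ge_min lexx.
have ek2 : 100 * k * e ^+ 2 <= 1.
  rewrite expr2 mulrA; apply: le_trans (_ : 1 * e <= 1).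
    by rewrite ler_wpM2r// ltW.
  by rewrite mul1r; apply: le_trans ek; rewrite ler_peMl ?ltW//; lra.
have e20 : 0 < e / 2 by rewrite divr_gt0.
have [m Am ml] := inf_adherent e20 hA.
case: Am => m0 [C C0 mC]; rewrite -/l0 in ml.
have k4 : 0 <= k * e ^+ 2 by rewrite mulr_ge0 ?sqr_ge0// ltW.
have lC : neumann_bounded (l0 + e / 2) (6 * k).
  apply: (neumann_bounded_near (ltW k0) lowk m0 ml mC).
    by rewrite lerDl divr_ge0// ltW.
  by rewrite addrAC subrr add0r exprMn; lra.
have lC' : neumann_bounded (l0 + e / 2 - e) (8 * (6 * k)).
  apply: (neumann_bounded_down _ m0 ml mC lC); [lra| exact: ltW | lra | lra].
have : A (l0 + e / 2 - e).
  by split; [lra | exists (8 * (6 * k)) => //; lra].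
move/(ge_inf hA.2); rewrite -/l0; lra.
Qed.

End Neumann.

(** * Finitely supported functions and positive matrices *)

Section FiniteSupport.
Variables (R : realType) (T : choiceType).
Implicit Types (u v : T -> R^o) (F : {fset T}).

Definition supported F v := forall t, t \notin F -> v t = 0.

Definition fin_cone : set (T -> R^o) :=
  [set v | (forall t, 0 <= v t) /\ exists F, supported F v].

Definition sqnorm v : R := \sum_(t \in [set: T]) v t ^+ 2.

Lemma supportedU F F' u v : supported F u -> supported F' v ->
  supported (F `|` F')%fset u /\ supported (F `|` F')%fset v.
Proof.
move=> hu hv; split=> t; rewrite in_fsetU negb_or => /andP[]; first by move/hu.
by move=> _ /hv.
Qed.

Lemma sqnormE F v : supported F v -> sqnorm v = \sum_(t <- F) v t ^+ 2.
Proof. by move=> Fv; apply: fsbigTE => t /Fv ->; rewrite expr0n. Qed.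

Lemma sqnorm_ge0 v : 0 <= sqnorm v.
Proof. by apply: fsumr_ge0 => t _; exact: sqr_ge0. Qed.

Lemma sqnormZ (c : R) v : sqnorm (c *: v) = c ^+ 2 * sqnorm v.
Proof. by rewrite mulr_fsumr; apply: eq_fsbigr => t _; rewrite -exprMn. Qed.

Lemma sqnormN v : sqnorm (- v) = sqnorm v.
Proof. by apply: eq_fsbigr => t _; exact: sqrrN. Qed.

Lemma sqnormD F u v : supported F u -> supported F v ->
  sqnorm (u + v) <= 2 * (sqnorm u + sqnorm v).
Proof.
move=> hu hv; rewrite (sqnormE hu) (sqnormE hv) (@sqnormE F) => [|t tF].
  rewrite -big_split mulr_sumr; apply: ler_sum => t _ /=.
  rewrite -[(u + v) t]/(u t + v t); have := sqr_ge0 (u t - v t); nra.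
by rewrite -[(u + v) t]/(u t + v t) hu// hv// addr0.
Qed.

Lemma sqnorm_le u v : fin_cone u -> fin_cone v -> sqnorm u <= sqnorm (u + v).
Proof.
move=> [u0 [F Fu]] [v0 [F' Fv]]; have [hu hv] := supportedU Fu Fv.
rewrite (sqnormE hu) (@sqnormE (F `|` F')%fset) => [|t tF].
  apply: ler_sum => t _; rewrite -[(u + v) t]/(u t + v t).
  by rewrite ler_sqr ?nnegrE ?addr_ge0// lerDl.
by rewrite -[(u + v) t]/(u t + v t) hu// hv// addr0.
Qed.

Lemma sqnorm_ge_coord F v : supported F v -> forall t, v t ^+ 2 <= sqnorm v.
Proof.
move=> Fv t; have [tF|/Fv->] := boolP (t \in F); last first.
  by rewrite expr0n sqnorm_ge0.
rewrite (sqnormE Fv) (big_fsetD1 t)//= lerDl sumr_ge0// => i _; exact: sqr_ge0.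
Qed.

End FiniteSupport.

Section PositiveMatrix.
Variables (R : realType) (T : choiceType) (m : T -> T -> R).
Implicit Types (u v : T -> R^o) (F : {fset T}).

Hypothesis m_ge0 : forall s t, 0 <= m s t.
Hypothesis m_row : forall s, exists F : {fset T}, supported F (m s).

Definition push v : T -> R^o := fun t => \sum_(s \in [set: T]) v s * m s t.

Lemma pushE F v t : supported F v -> push v t = \sum_(s <- F) v s * m s t.
Proof. by move=> Fv; apply: fsbigTE => s /Fv ->; rewrite mul0r. Qed.

Lemma push_supported F v : supported F v -> exists F', supported F' (push v).
Proof.
move=> Fv; have /choice[G hG] := m_row.
exists (\bigcup_(s <- F) G s)%fset => t tF.
rewrite (pushE _ Fv) big_seq big1// => s sF.
rewrite hG ?mulr0//; apply: contra tF => tG.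
by apply/bigfcupP; exists s; rewrite ?sF.
Qed.

Lemma push_positive : positive_operator (@fin_cone R T) (@sqnorm R T) push.
Proof.
split.
- by split=> //; exists fset0.
- move=> u v [u0 [F Fu]] [v0 [F' Fv]]; have [hu hv] := supportedU Fu Fv.
  split=> [t|]; first exact: addr_ge0.
  by exists (F `|` F')%fset => t tF; rewrite -[LHS]/(u t + v t) hu// hv// addr0.
- move=> c u c0 [u0 [F Fu]]; split=> [t|]; first exact: mulr_ge0.
  by exists F => t tF; rewrite -[LHS]/(c * u t) Fu// mulr0.
- exact: sqnorm_ge0.
- exact: sqnormZ.
- move=> u v [u0 [F Fu]] [v0 [F' Fv]]; have [hu hv] := supportedU Fu Fv.
  exact: sqnormD hu hv.
- exact: sqnorm_le.
- move=> u [u0 [F Fu]]; split; last exact: push_supported Fu.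
  by move=> t; apply: fsumr_ge0 => s _; exact: mulr_ge0.
- move=> u v [u0 [F Fu]] [v0 [F' Fv]]; have [hu hv] := supportedU Fu Fv.
  apply/funext => t; rewrite -[RHS]/(push u t + push v t).
  rewrite (pushE _ hu) (pushE _ hv) (@pushE (F `|` F')%fset) => [|s sF].
    by rewrite -big_split; apply: eq_bigr => s _; exact: mulrDl.
  by rewrite -[LHS]/(u s + v s) hu// hv// addr0.
- move=> c u c0 [u0 [F Fu]]; apply/funext => t; rewrite -[RHS]/(c * push u t).
  by rewrite mulr_fsumr; apply: eq_fsbigr => s _; exact/esym/mulrA.
Qed.

End PositiveMatrix.

Section ComplexEmbedding.
Variables (R : realType) (T : choiceType).
Implicit Types (u v : T -> R^o) (F : {fset T}).

Definition toC v : T -> R[i] := fun t => (v t)%:C.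

Lemma normcR (x : R) : normc x%:C = `|x|.
Proof. by rewrite /= expr0n addr0 sqrtr_sqr. Qed.

Lemma sqsum_toC v : sqsum (toC v) = \esum_(t in [set: T]) (v t ^+ 2)%:E.
Proof. by apply: eq_esum => t _; rewrite normcR real_normK// num_real. Qed.

Lemma sqsum_fin F v : supported F v -> sqsum (toC v) = (sqnorm v)%:E.
Proof.
move=> Fv; rewrite sqsum_toC (sqnormE Fv) -sumEFin.
transitivity (\esum_(t in [set` F]) (v t ^+ 2)%:E).
  rewrite [RHS]esum_mkcond; apply: eq_esum => t _.
  by case: ifPn => //; rewrite mem_setE => /Fv ->; rewrite expr0n.
rewrite esum_fset//; first by rewrite -fsbig_seq ?fset_uniq.
by move=> t _; rewrite lee_fin; exact: sqr_ge0.
Qed.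

Lemma norm_normc (z : R[i]) : `|z| = (normc z)%:C.
Proof. by case: z. Qed.

Lemma ler_sum_fset F (A : {fset T}) (g : T -> R) : (forall s, 0 <= g s) ->
  (F `<=` A)%fset -> \sum_(s <- F) g s <= \sum_(s <- A) g s.
Proof.
move=> g0 FA; rewrite (big_fsetID _ (mem F) A)/=.
have -> : [fset x in A | x \in F]%fset = F.
  by apply/fsetP => x; rewrite !inE; apply: andb_idl => /(fsubsetP FA).
by rewrite lerDl sumr_ge0.
Qed.

Lemma partial_sumE F (f : T -> R[i]) :
  summability.partial_sum (f : T -> R[i]^o) F = \sum_(s <- F) f s.
Proof. by rewrite big_seq_fsetE. Qed.

Lemma totally_above F :
  summability.totally [set A : {fset T} | (F `<=` A)%fset].
Proof. by exists F. Qed.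

Lemma family_sum_fin F (f : T -> R[i]) : (forall s, s \notin F -> f s = 0) ->
  family_sum f = \sum_(s <- F) f s.
Proof.
move=> Ff; have FF := @summability.totally_filter T.
apply: (@norm_lim_near_cst _ R[i]^o _ (summability.totally)).
exists F => // A /= FA; rewrite partial_sumE; apply/esym.
by apply: big_fset_incl => // s _; exact: Ff.
Qed.

(** If the sum of a nonnegative family had modulus below a partial sum, all
    larger partial sums would stay away from it. *)
Lemma family_sum_ge F (g : T -> R) : (forall s, 0 <= g s) ->
  summable_family (fun s => (g s)%:C) ->
  \sum_(s <- F) g s <= normc (family_sum (fun s => (g s)%:C)).
Proof.
move=> g0 cv; set l := family_sum _; rewrite leNgt; apply/negP => lt.
set e := \sum_(s <- F) g s - normc l.
have e0 : 0 < e by rewrite subr_gt0.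
have FF := @summability.totally_filter T.
have /cvgrPdist_lt/(_ e%:C) := cv; rewrite ltcR => /(_ e0) cl.
have [A [/= FA /=]] := filter_ex (filterI (totally_above F) cl).
rewrite partial_sumE -/(family_sum _) -/l -rmorph_sum => close.
have FAg : \sum_(s <- F) g s <= \sum_(s <- A) g s by exact: ler_sum_fset.
have := ler_normD (l - (\sum_(s <- A) g s)%:C) (- l).
rewrite addrAC subrr add0r !normrN => tri.
have := le_lt_trans tri (ltr_leD close (lexx _)).
rewrite !norm_normc normcR -rmorphD ltcR /e subrK ger0_norm ?sumr_ge0//.
by rewrite ltNge FAg.
Qed.

End ComplexEmbedding.

(** * Positive matrices defined on square summable functions *)

Lemma esum_interchange (R : realType) (I J : choiceType)
    (a : I -> J -> \bar R) :
  (forall i j, (0 <= a i j)%E) ->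
  \esum_(i in [set: I]) \esum_(j in [set: J]) a i j =
  \esum_(j in [set: J]) \esum_(i in [set: I]) a i j.
Proof.
move=> a0; rewrite !esum_esum//.
rewrite (reindex_esum ([set: J] `*`` fun=> [set: I]) _ (fun x => (x.2, x.1)))//.
split=> //=.
  by move=> [i1 i2] [j1 j2] /= _ _ [] -> ->.
by move=> [i1 i2] _ /=; exists (i2, i1).
Qed.

Section PositiveMatrixL2.
Variables (R : realType) (T : choiceType) (m : T -> T -> R).
Implicit Types (u v : T -> R^o) (F : {fset T}).

Hypothesis m_ge0 : forall s t, 0 <= m s t.
Hypothesis m_row : forall s, exists F : {fset T}, supported F (m s).

Let M s t : R[i] := (m s t)%:C.
Let posP := push_positive m_ge0 m_row.

Lemma l2_fin F v : supported F v -> l2 (toC v).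
Proof. by move=> Fv; rewrite /l2 /= (sqsum_fin Fv) ltry. Qed.

Lemma l2norm_fin F v : supported F v -> l2norm (toC v) = Num.sqrt (sqnorm v).
Proof. by move=> Fv; rewrite /l2norm (sqsum_fin Fv). Qed.

Lemma mxact_toC F v : supported F v -> mxact M (toC v) = toC (push m v).
Proof.
move=> Fv; apply/funext => t; rewrite /mxact (@family_sum_fin _ _ F).
  rewrite /toC (pushE _ _ Fv) rmorph_sum; apply: eq_bigr => s _.
  by rewrite rmorphM.
by move=> s sF; rewrite /toC Fv// mul0r.
Qed.

Lemma supportedB (l : R) F F' u v : supported F u -> supported F' v ->
  supported (F `|` F')%fset (u - l *: v).
Proof.
move=> Fu Fv; have [hu hv] := supportedU Fu Fv.
by move=> t tF; rewrite -[LHS]/(u t - l * v t) hu// hv// mulr0 subr0.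
Qed.

(** [u] is recovered from [P u - l u] by the bounded inverse; both functions are
    finitely supported, so their [l2] norms are finite sums. *)
Lemma bounded_below_of_invertible (l : R) :
  l2_invertible (fun f t => mxact M f t - l%:C * f t) ->
  exists K, bounded_below (@fin_cone R T) (@sqnorm R T) (push m) l K.
Proof.
move=> [B [_ _ [K BK]] BA]; exists (2 * K ^+ 2) => u a b [u0 [F Fu]].
move=> [_ [Fa hFa]] [_ [Fb hFb]] e.
have [F1 Fp] := push_supported m_row Fu.
have Fd := supportedB l Fp Fu.
have AE : (fun t => mxact M (toC u) t - l%:C * toC u t)
    = toC (push m u - l *: u).
  apply/funext => t; rewrite (mxact_toC Fu) /toC.
  by rewrite -[(_ - _) t]/(push m u t - l * u t) rmorphB rmorphM.
have := BK _ (l2_fin Fd); rewrite -AE (BA _ (l2_fin Fu)).1 AE.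
rewrite (l2norm_fin Fu) (l2norm_fin Fd) => le.
have : sqnorm u <= K ^+ 2 * sqnorm (push m u - l *: u).
  rewrite -(sqr_sqrtr (sqnorm_ge0 u)) -(sqr_sqrtr (sqnorm_ge0 (_ - _))).
  rewrite -exprMn ler_sqr ?nnegrE ?sqrtr_ge0//.
  by apply: le_trans le; exact: sqrtr_ge0.
have -> : push m u - l *: u = b - a.
  by apply/eqP; rewrite subr_eq addrAC -subr_eq opprK e addrC.
move/le_trans; apply.
rewrite [leRHS](_ : _ = K ^+ 2 * (2 * (sqnorm a + sqnorm b))); last ring.
rewrite ler_wpM2l ?sqr_ge0//.
have [hb ha] := supportedU hFb hFa.
have hNa : supported (Fb `|` Fa)%fset (- a).
  by move=> t tF; rewrite -[LHS]/(- a t) ha// oppr0.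
by have := sqnormD hb hNa; rewrite sqnormN (addrC (sqnorm b)).
Qed.

(** The pointwise [l2] norm of the sequence, [sqrt (sum_k (w_k t)^2)], dominates
    each term and is square summable with the sum of the squared norms. *)
Lemma l2_dominating (w : nat -> T -> R^o) :
  (forall k, fin_cone (w k)) ->
  (forall k, sqnorm (w k) <= (2 ^ (k + 1))%:R^-1) ->
  exists w' : T -> R^o, [/\ forall t, 0 <= w' t, l2 (toC w') &
    forall k t, w k t <= w' t].
Proof.
move=> wD wn.
pose G t := (\esum_(k in [set: nat]) (w k t ^+ 2)%:E)%E.
have G0 t : (0 <= G t)%E by apply: esum_ge0 => k _; rewrite lee_fin sqr_ge0.
have sumG : (\esum_(t in [set: T]) G t <= 1%:E)%E.
  rewrite esum_interchange => [|i j]; last by rewrite lee_fin sqr_ge0.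
  have -> : 1%:E =
      (\esum_(k in [set: nat]) ((1 / (2 ^ (k + 1))%:R)%:E : \bar R))%E.
    rewrite -nneseries_esumT => [|k]; last by rewrite lee_fin divr_ge0.
    apply/esym/cvg_lim => //.
    by have := @cvg_geometric_eseries_half R 1 0; rewrite expr0 divr1.
  apply: le_esum => k _; have [_ [F Fw]] := wD k.
  by rewrite -sqsum_toC (sqsum_fin Fw) lee_fin div1r.
have Gfin t : G t \is a fin_num.
  rewrite ge0_fin_numE//; apply: le_lt_trans (ltry 1).
  apply: le_trans sumG; rewrite -[X in (X <= _)%E](@esum_set1 R T t)//.
  rewrite [leLHS]esum_mkcond; apply: le_esum => s _; case: ifPn => //.
exists (fun t => Num.sqrt (fine (G t))); split.
- by move=> t; exact: sqrtr_ge0.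
- rewrite /l2 /= sqsum_toC; apply: le_lt_trans (ltry 1); apply: le_trans sumG.
  apply: le_esum => t _; rewrite sqr_sqrtr ?fine_ge0//.
  by rewrite fineK.
- move=> k t; have [w0 _] := wD k.
  rewrite -(ger0_norm (w0 t)) -sqrtr_sqr ler_sqrt ?fine_ge0// -lee_fin fineK//.
  rewrite -[leLHS](@esum_set1 R nat k (fun j => (w j t ^+ 2)%:E)).
    rewrite esum_mkcond; apply: le_esum => j _; case: ifPn => // _.
    by rewrite lee_fin sqr_ge0.
  by rewrite lee_fin sqr_ge0.
Qed.

(** Boundedness of a nonnegative matrix follows by domination: if the images of
    small vectors [w_k] were arbitrarily large, one square summable function
    above all [w_k] would have an image above all of theirs. *)
Lemma push_bounded : defined_on_l2 M ->
  exists2 K, 0 <= K &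
    forall v, fin_cone v -> sqnorm (push m v) <= K * sqnorm v.
Proof.
move=> Mdef; apply: contrapT => nK.
have large k : exists w : T -> R^o, [/\ fin_cone w,
    sqnorm w <= (2 ^ (k + 1))%:R^-1 & k%:R < sqnorm (push m w)].
  pose c : R := (2 ^ (k + 1))%:R.
  have c0 : 0 < c by rewrite ltr0n expn_gt0.
  have kc : k%:R < c by rewrite ltr_nat addn1 (ltn_trans _ (ltn_expl _ _)).
  apply: contrapT => nw; apply: nK; exists (c * c); first exact/ltW/mulr_gt0.
  move=> v Dv; rewrite leNgt; apply/negP => lt.
  have [v0 [F Fv]] := Dv.
  have [q0|q0] := eqVneq (sqnorm v) 0.
    have vE : v = 0.
      apply/funext => t; apply/eqP; rewrite -sqrf_eq0 eq_le sqr_ge0 andbT.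
      by rewrite -q0; exact: sqnorm_ge_coord Fv _.
    have : sqnorm (push m v) = 0 by rewrite vE (op0 posP) -vE.
    by move: lt => /[swap] ->; rewrite q0 mulr0 ltxx.
  have q1 : 0 < sqnorm v by rewrite lt_def q0 sqnorm_ge0.
  (* This factor gives squared norm [1 / c]; as [push] multiplies the squared
     norm of [v] by more than [c * c], the image then has squared norm
     above [c]. *)
  pose a := (Num.sqrt (c * sqnorm v))^-1.
  have a0 : 0 <= a by rewrite invr_ge0 sqrtr_ge0.
  have a2 : a ^+ 2 = (c * sqnorm v)^-1.
    by rewrite exprVn sqr_sqrtr// mulr_ge0// ltW.
  apply: nw; exists (a *: v); split.
  - exact: (coneZ posP).
  - by rewrite sqnormZ a2 invfM mulfVK.
  - rewrite (opZ posP)// sqnormZ a2; apply: lt_trans kc _.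
    by rewrite ltr_pdivlMl ?mulr_gt0// mulrAC.
have [w hw] := choice large.
have [w' [w'0 l2w' ww']] :=
  l2_dominating (fun k => let: And3 h _ _ := hw k in h)
                (fun k => let: And3 _ h _ := hw k in h).
have [Msum Ml2] := Mdef _ l2w'.
have ub k : ((k%:R)%:E < sqsum (mxact M (toC w')))%E.
  have [[wk0 [F Fw]] _ lt] := hw k.
  apply: (@lt_le_trans _ _ (sqnorm (push m (w k)))%:E).
    by rewrite lte_fin.
  have [F' Fp] := push_supported m_row Fw.
  rewrite -(sqsum_fin Fp) sqsum_toC; apply: le_esum => t _; rewrite lee_fin.
  have p0 : 0 <= push m (w k) t.
    by apply: fsumr_ge0 => s _; rewrite mulr_ge0.
  have le : push m (w k) t <= normc (mxact M (toC w') t).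
    have gE : (fun s => toC w' s * M s t) = (fun s => (w' s * m s t)%:C).
      by apply/funext => s; rewrite rmorphM.
    have := Msum t; rewrite /mxact gE => /(family_sum_ge F) h.
    apply: le_trans (h _); last by move=> s; rewrite mulr_ge0.
    by rewrite (pushE _ _ Fw); apply: ler_sum => s _; rewrite ler_wpM2r.
  by rewrite ler_sqr// nnegrE (le_trans p0).
move: Ml2; rewrite /l2 /= => fin.
have S0 : (0 <= sqsum (mxact M (toC w')))%E.
  by apply: esum_ge0 => t _; rewrite lee_fin sqr_ge0.
have Sfin : sqsum (mxact M (toC w')) \is a fin_num by rewrite ge0_fin_numE.
move: ub; rewrite -(fineK Sfin); move: (fine _) => x ub.
have := ub (Num.truncn x).+1; rewrite lte_fin ltNge => /negP; apply.
exact/ltW/truncnS_gt.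
Qed.

End PositiveMatrixL2.

(** * Random walks and Folner sets *)

Section Walk.
Variables (R : realType) (T : choiceType) (X : finType) (act : X -> T -> T).
Implicit Types (u v : T -> R^o) (F E G : {fset T}).
Hypothesis X_gt0 : (0 < #|X|)%N.

Definition walk (s t : T) : R :=
  #|[set x : X | act x s == t]%SET|%:R / #|X|%:R.

Definition exits F x : {fset T} := [fset s in F | act x s \notin F]%fset.

Definition indicator F : T -> R^o := fun t => (t \in F)%:R.

Let cX : 0 < #|X|%:R :> R. Proof. by rewrite ltr0n. Qed.

Lemma walk_ge0 s t : 0 <= walk s t.
Proof. by rewrite divr_ge0. Qed.

Lemma walkE s t : walk s t = #|X|%:R^-1 * \sum_x (act x s == t)%:R.
Proof.
rewrite /walk mulrC -sum1_card natr_sum big_mkcond; congr (_ * _).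
by apply: eq_bigr => x _; rewrite inE; case: eqP.
Qed.

Lemma walk_row s : exists F, supported F (walk s).
Proof.
exists [fset act x s | x : X]%fset => t tF.
rewrite walkE big1 ?mulr0// => x _; case: eqP => // e.
by case/negP: tF; rewrite -e; apply/imfsetP; exists x.
Qed.

Let posP := push_positive walk_ge0 walk_row.

Lemma sum_eq_mem E (t : T) : \sum_(s <- E) (t == s)%:R = (t \in E)%:R :> R.
Proof.
have [tE|tE] := boolP (t \in E); last first.
  by rewrite big_seq big1// => s sE; case: eqP => // e; rewrite e sE in tE.
rewrite (big_fsetD1 t)//= eqxx big_seq big1 ?addr0// => s.
by rewrite !inE eq_sym => /andP[/negbTE->].
Qed.

Lemma sum_push E G u : supported G u ->
  \sum_(t <- E) push walk u t =
  #|X|%:R^-1 * \sum_x \sum_(s <- G) u s * (act x s \in E)%:R.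
Proof.
move=> Gu; under eq_bigr do rewrite (pushE _ _ Gu).
rewrite [LHS]exchange_big [in RHS]exchange_big/= mulr_sumr.
apply: eq_bigr => s _; rewrite -!mulr_sumr [RHS]mulrCA; congr (_ * _).
under eq_bigr do rewrite walkE.
rewrite -mulr_sumr exchange_big; congr (_ * _).
by apply: eq_bigr => x _; rewrite /= sum_eq_mem.
Qed.

Lemma sum_fset_const F (c : R) : \sum_(t <- F) c = c * #|` F|%:R.
Proof. by rewrite big_const_seq count_predT iter_addr_0 mulr_natr. Qed.

Lemma supported_indicator F : supported F (indicator F).
Proof. by move=> t /negbTE tF; rewrite /indicator tF. Qed.

Lemma sqnorm_indicator F : sqnorm (indicator F) = #|` F|%:R.
Proof.
rewrite (sqnormE (@supported_indicator F)) -[RHS]mul1r -sum_fset_const.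
by apply: eq_big_seq => t tF; rewrite /indicator tF expr1n.
Qed.

Lemma cone_indicator F : fin_cone (indicator F).
Proof.
by split=> [t|]; [exact: ler0n|exists F; exact: supported_indicator].
Qed.

(** A linearized Cauchy-Schwarz inequality: [2 x <= a x^2 + a^-1] at each point
    of [F]. *)
Lemma sum_le_sqnorm F G u (a : R) : supported G u -> 0 < a ->
  2 * \sum_(t <- F) u t <= a * sqnorm u + a^-1 * #|` F|%:R.
Proof.
move=> Gu a0; have [hG _] := supportedU Gu (@supported_indicator F).
apply: (@le_trans _ _ (a * \sum_(t <- F) u t ^+ 2 + a^-1 * #|` F|%:R)).
  rewrite -sum_fset_const !mulr_sumr -big_split; apply: ler_sum => t _ /=.
  have := mulr_ge0 (ltW a0) (sqr_ge0 (u t - a^-1)).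
  have -> : a * (u t - a^-1) ^+ 2
      = a * u t ^+ 2 - 2 * (a * a^-1) * u t + a * a^-1 * a^-1 by ring.
  rewrite divff ?gt_eqF//; lra.
rewrite lerD2r ler_pM2l// (sqnormE hG) ler_sum_fset//; last exact: fsubsetUr.
by move=> t; exact: sqr_ge0.
Qed.

(** One step of the walk carries mass at least [1 / |X|] from each point of
    [exits F x] into the set [E] of new points.  If [E] were much smaller than
    [exits F x], the image of the indicator function would be too concentrated
    for a bounded operator. *)
Lemma card_exits (K : R) F x : 0 < K ->
  (forall v, fin_cone v -> sqnorm (push walk v) <= K * sqnorm v) ->
  #|` exits F x|%:R <=
    K * #|X|%:R ^+ 2 * #|` ([fset act x f | f in F] `\` F)%fset|%:R.
Proof.
move=> K0 PK; set E := (_ `\` _)%fset; set B := exits F x.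
pose a := (K * #|X|%:R)^-1; have a0 : 0 < a by rewrite invr_gt0 mulr_gt0.
have [G Gp] := push_supported walk_row (@supported_indicator B).
have le1 := sum_le_sqnorm E Gp a0.
have le2 : #|X|%:R^-1 * #|` B|%:R <= \sum_(t <- E) push walk (indicator B) t.
  rewrite (sum_push _ (@supported_indicator B)) ler_pM2l ?invr_gt0//.
  rewrite (bigD1 x)//= -[leLHS]addr0 lerD//.
    rewrite -[leLHS]mul1r -sum_fset_const big_seq [leRHS]big_seq.
    apply: ler_sum => s sB; rewrite /indicator sB mul1r.
    move: sB; rewrite !inE /= => /andP[sF nF].
    by rewrite nF in_imfset.
  by apply: sumr_ge0 => y _; apply: sumr_ge0 => s _; rewrite mulr_ge0 ?ler0n.
have := PK _ (cone_indicator B); rewrite sqnorm_indicator => le3.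
have {}le3 : a * sqnorm (push walk (indicator B)) <= #|X|%:R^-1 * #|` B|%:R.
  apply: (le_trans (ler_wpM2l (ltW a0) le3)).
  by rewrite mulrA [a * K](_ : _ = #|X|%:R^-1)// /a; field; rewrite !gt_eqF.
have {le1 le2 le3} le4 : #|X|%:R^-1 * #|` B|%:R <= K * #|X|%:R * #|` E|%:R.
  rewrite -[K * _]invrK -/a; lra.
by rewrite mulrC ler_pdivrMr// in le4; rewrite expr2 mulrA mulrAC.
Qed.

(** The mass of [u] on [F] that a step [x] does not carry out of [F] is still
    in [F] afterwards; the mass coming from outside is nonnegative. *)
Lemma mass_push F u : fin_cone u ->
  \sum_(t <- F) u t - #|X|%:R^-1 * \sum_x \sum_(s <- exits F x) u s
  <= \sum_(t <- F) push walk u t.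
Proof.
move=> [u0 [G Gu]]; have [hG _] := supportedU Gu (@supported_indicator F).
have -> : \sum_(t <- F) u t = #|X|%:R^-1 * \sum_(x : X) \sum_(t <- F) u t.
  by rewrite sumr_const -[X in _ = _ * X]mulr_natl mulKf// gt_eqF.
rewrite -mulrBr (sum_push _ hG) ler_pM2l ?invr_gt0// -sumrB.
apply: ler_sum => x _; rewrite (big_fsetID _ (fun s => act x s \in F) F)/=.
rewrite addrK; set F1 := [fset s in F | act x s \in F]%fset.
apply: (@le_trans _ _ (\sum_(s <- F1) u s * (act x s \in F)%:R)).
  rewrite big_seq [leRHS]big_seq; apply: ler_sum => s.
  by rewrite !inE => /andP[_ ->]; rewrite mulr1.
apply: ler_sum_fset => [s|]; first by rewrite mulr_ge0.
by apply/fsubsetP => s; rewrite !inE => /andP[-> _]; rewrite orbT.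
Qed.

(** The mass of the [n]-th Neumann sum on a Folner set grows linearly in [n],
    while its squared norm stays bounded. *)
Lemma folner_not_neumann_bounded (K C : R) : 0 < K -> 0 <= C ->
  (forall v, fin_cone v -> sqnorm (push walk v) <= K * sqnorm v) ->
  (forall eps : R, 0 < eps -> exists2 F, F != fset0 & forall x,
     #|` ([fset act x f | f in F] `\` F)%fset|%:R <= eps * #|` F|%:R) ->
  ~ neumann_bounded (@fin_cone R T) (@sqnorm R T) (push walk) 1 C.
Proof.
move=> K0 C0 PK fol bd.
pose c := C + 1; have c0 : 0 < c by rewrite ltr_wpDl.
pose k := K * #|X|%:R ^+ 2; have k0 : 0 < k by rewrite mulr_gt0 ?exprn_gt0.
(* Chosen for [sum_le_sqnorm] with the weight [a = 1 / (2 c)]: both terms of its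
   bound for twice the lost mass become at most [f / 2]. *)
have eps0 : 0 < (4 * c * k)^-1 by rewrite invr_gt0 !mulr_gt0.
have [F Fn0 Feps] := fol _ eps0.
set f := #|` F|%:R : R in Feps.
have f0 : 0 < f by rewrite ltr0n cardfs_gt0.
pose v := indicator F; pose s := neumann (push walk) 1 v.
have Dv : fin_cone v by exact: cone_indicator.
have Ds n : fin_cone (s n) by exact: (cone_neumann posP n ltr01 Dv).
have Qs n : sqnorm (s n) <= C * f.
  by have := bd v n Dv; rewrite sqnorm_indicator.
have loss n x : \sum_(t <- exits F x) s n t <= f / 2.
  have [_ [G Gs]] := Ds n.
  have a0 : 0 < (2 * c)^-1 by rewrite invr_gt0 mulr_gt0.
  have le1 := sum_le_sqnorm (exits F x) Gs a0.
  have le2 : 2 * c * #|` exits F x|%:R <= f / 2.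
    have := card_exits F x K0 PK; rewrite -/k => /le_trans h.
    have {}h := h _ (ler_wpM2l (ltW k0) (Feps x)).
    have := ler_wpM2l (ltW (mulr_gt0 (ltr0Sn R 1) c0)) h.
    move/le_trans; apply; rewrite le_eqVlt; apply/orP; left; apply/eqP.
    by field; rewrite !gt_eqF.
  have le3 : (2 * c)^-1 * sqnorm (s n) <= f / 2.
    rewrite ler_pdivrMl ?mulr_gt0//; apply: (le_trans (Qs n)).
    by rewrite /c; lra.
  rewrite invrK in le1; lra.
have grow n : n%:R * (f / 2) <= \sum_(t <- F) s n t.
  elim: n => [|n IH]; first by rewrite mul0r big1.
  have sE t : s n.+1 t = v t + push walk (s n) t.
    by rewrite /s /neumann iterS invr1 scale1r.
  under eq_bigr do rewrite sE; rewrite big_split/=.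
  have -> : \sum_(t <- F) v t = f.
    rewrite -[RHS]mul1r -sum_fset_const; apply: eq_big_seq => t tF.
    by rewrite /v /indicator tF.
  have mass := mass_push F (Ds n).
  have avg : #|X|%:R^-1 * \sum_x \sum_(t <- exits F x) s n t <= f / 2.
    rewrite ler_pdivrMl//; apply: (@le_trans _ _ (\sum_(x : X) f / 2)).
      by apply: ler_sum => x _; exact: loss.
    by rewrite sumr_const [leRHS]mulr_natl.
  rewrite -[n.+1%:R]natr1; lra.
pose n := (Num.truncn (2 * c)).+1.
have nc : 2 * c < n%:R by exact: truncnS_gt.
have [_ [G Gs]] := Ds n.
have := sum_le_sqnorm F Gs ltr01; rewrite invr1 !mul1r -/f.
have := grow n; have := Qs n; have : 2 * c * f < n%:R * f by rewrite ltr_pM2r.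
rewrite /c; have : 0 <= C * f by rewrite mulr_ge0// ltW.
move: (n%:R * f) (mulrA n%:R f 2^-1) => y; lra.
Qed.

End Walk.

(** * The spectral radius *)

Theorem walk_spectral_radius_ge1 (R : realType) (T : choiceType) (X : finType)
    (act : X -> T -> T) :
  (0 < #|X|)%N ->
  (forall eps : R, 0 < eps -> exists2 F : {fset T}, F != fset0 & forall x,
     #|` ([fset act x f | f in F] `\` F)%fset|%:R <= eps * #|` F|%:R) ->
  let M s t : R[i] := (walk R act s t)%:C in
  ~ defined_on_l2 M \/ (1%:E <= spectral_radius M)%E.
Proof.
move=> X0 fol M; have [Mdef|] := pselect (defined_on_l2 M); last by left.
right; rewrite leNgt; apply/negP => small.
have m0 := @walk_ge0 R T X act; have m1 := walk_row R act.
have [K K0 PK] := push_bounded m0 m1 Mdef.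
have low (l : R) : 1 <= l ->
    exists K', bounded_below (@fin_cone R T) (@sqnorm R T)
                             (push (walk R act)) l K'.
  move=> l1; apply: bounded_below_of_invertible => //; apply: contrapT => nI.
  move: small; rewrite ltNge => /negP; apply.
  apply: (@le_trans _ _ (normc l%:C)%:E).
    by rewrite lee_fin normcR (le_trans l1)// ler_norm.
  by apply: ereal_sup_ubound; exists l%:C.
have [C C0 bd] := neumann_bounded_from (push_positive m0 m1) ltr01 K0 PK low.
apply: (folner_not_neumann_bounded X0 (K := K + 1) _ C0 _ fol bd).
  by rewrite ltr_wpDl.
move=> v Dv; apply: (le_trans (PK v Dv)).
by rewrite ler_wpM2r ?sqnorm_ge0// lerDl.
Qed.

(** The Folner sets live in the semigroup and the walk in the semigroup with
    an identity adjoined, so they are transported along the inclusion. *)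
Lemma walk_extension_ge1 (R : realType) (S T : choiceType) (X : finType)
    (i : S -> T) (actS : X -> S -> S) (act : X -> T -> T) :
  injective i -> (forall x s, act x (i s) = i (actS x s)) -> (0 < #|X|)%N ->
  (forall eps : R, 0 < eps -> exists2 F : {fset S}, F != fset0 & forall x,
     #|` ([fset actS x f | f in F] `\` F)%fset|%:R <= eps * #|` F|%:R) ->
  let M s t : R[i] := (walk R act s t)%:C in
  ~ defined_on_l2 M \/ (1%:E <= spectral_radius M)%E.
Proof.
move=> inji actE X0 fol; apply: walk_spectral_radius_ge1 => // eps eps0.
have [F F0 Feps] := fol eps eps0.
exists [fset i f | f in F]%fset.
  by rewrite -cardfs_gt0 card_imfset//= cardfs_gt0.
move=> x; rewrite [X in _ * X%:R]card_imfset//=.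
apply: le_trans (Feps x); rewrite ler_nat.
set E := ([fset actS x f | f in F] `\` F)%fset.
apply: (@leq_trans #|` [fset i f | f in E]|%fset); last by rewrite card_imfset.
apply: fsubset_leq_card; apply/fsubsetP => t; rewrite in_fsetD => /andP[tF].
move=> /imfsetP[g /imfsetP[f /= fF ->] tE]; rewrite actE in tE.
rewrite tE in tF *; rewrite mem_imfset//= in tF.
by rewrite mem_imfset//= in_fsetD tF in_imfset.
Qed.

Lemma generators_gt0 (S : semigroupType) (X : finType)
    (ev : {multiplicative free_semigroup X -> S}) (s : S) :
  choice_of_generators ev -> (0 < #|X|)%N.
Proof.
by move=> /(_ s)[[[|x w] // _] _]; apply/card_gt0P; exists x.
Qed.

Theorem theorem5p12 (R : realType) (S : semigroupType) :
  finitely_generated S ->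
  (right_folner R S ->
   forall (X : finType) (ev : {multiplicative free_semigroup X -> S}),
     choice_of_generators ev ->
     ~ defined_on_l2 (right_markov R ev) \/
     (1%:E <= spectral_radius (right_markov R ev))%E)
  /\
  (left_folner R S ->
   forall (X : finType) (ev : {multiplicative free_semigroup X -> S}),
     choice_of_generators ev ->
     ~ defined_on_l2 (left_markov R ev) \/
     (1%:E <= spectral_radius (left_markov R ev))%E).
Proof.
move=> _; split=> fol X ev gen; have [F1 /fset0Pn[s _] _] := fol fset0 1 ltr01.
- pose act (x : X) (s : adjoin1 S) := (s * to_adjoin1 (ev (letter x)))%g.
  have -> : right_markov R ev = fun s t => (walk R act s t)%:C.
    by apply/funext => a; apply/funext => t; rewrite fmorph_div !rmorph_nat.
  apply: (walk_extension_ge1 (actS := fun x f => (f * ev (letter x))%g)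
    (@to_adjoin1_inj S) _ (generators_gt0 s gen)) => [x f|eps eps0].
    by rewrite to_adjoin1M.
  have [F F0 Feps] := fol [fset ev (letter x) | x : X]%fset eps eps0.
  by exists F => // x; apply: Feps; apply/imfsetP; exists x.
- pose act (x : X) (s : adjoin1 S) := (to_adjoin1 (ev (letter x)) * s)%g.
  have -> : left_markov R ev = fun s t => (walk R act s t)%:C.
    by apply/funext => a; apply/funext => t; rewrite fmorph_div !rmorph_nat.
  apply: (walk_extension_ge1 (actS := fun x f => (ev (letter x) * f)%g)
    (@to_adjoin1_inj S) _ (generators_gt0 s gen)) => [x f|eps eps0].
    by rewrite to_adjoin1M.
  have [F F0 Feps] := fol [fset ev (letter x) | x : X]%fset eps eps0.
  by exists F => // x; apply: Feps; apply/imfsetP; exists x.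
Qed.
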